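(* For every integer $w\geq 1$, every poset $P$ of width $w$ satisfies $\operatorname{qn}(P)\leq w^2-2\lfloor w/2\rfloor$.
   Context: All posets are finite and nonempty. For elements $a,b$ of a poset $P$, write $a \prec b$ (a cover relation, or cover) if $a<b$ and there is no $c\in P$ with $a<c<b$. The width of $P$ is the maximum number of pairwise incomparable elements. A linear extension $L$ of $P$ is a linear order on the elements of $P$ such that $x<_L y$ whenever $x<_P y$. A rainbow of size $k$ (a $k$-rainbow) with respect to $L$ is a set of $k$ covers $a_1\prec b_1,\dots,a_k\prec b_k$ of $P$ with $a_1<_L\cdots<_L a_k<_L b_k<_L\cdots<_L b_1$. The queue-number $\operatorname{qn}(P)$ is the smallest $k$ such that there is a linear extension $L$ of $P$ with respect to which the covers of $P$ contain no $(k+1)$-rainbow. *)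

(* Defs.v *)
From HB Require Import structures.
From mathcomp Require Import all_boot all_order.
Set Implicit Arguments.
Unset Strict Implicit.
Unset Printing Implicit Defensive.
Import Order.TTheory.

Local Open Scope order_scope.

Section QueueNumber.
Context {d : Order.disp_t} (T : finPOrderType d).
Implicit Types (a b x y z : T) (A : {set T}) (L : rel T) (k : nat).

Definition covers a b : bool :=
  (a < b) && ~~ [exists c, (a < c) && (c < b)].

Definition antichain A : bool :=
  [forall x in A, forall y in A, (x != y) ==> (x >< y)].

Definition width : nat := (\max_(A : {set T} | antichain A) #|A|)%N.

(* A linear order is represented by its strict relation. *)
Definition linear_extension L : bool :=
  [&& [forall x, ~~ L x x],
      [forall x, forall y, forall z, L x y ==> L y z ==> L x z],
      [forall x, forall y, (x != y) ==> L x y || L y x]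
    & [forall x, forall y, (x < y) ==> L x y]].

(* The i-th entry of s is the pair (a_i, b_i). As L is strict and transitive,
   the sortedness condition reads a_1 < ... < a_k < b_k < ... < b_1 in L, and
   in particular it forces the k covers to be distinct. *)
Definition is_rainbow L (s : seq (T * T)) : bool :=
  all (fun p => covers p.1 p.2) s
  && sorted L (map fst s ++ rev (map snd s)).

Definition has_rainbow L k : bool :=
  [exists s : k.-tuple (T * T), is_rainbow L s].

(* Relations are encoded as finite functions so as to be quantified over in
   bool. *)
Definition queue_layout k : bool :=
  [exists L : {ffun T * T -> bool},
    linear_extension (fun x y => L (x, y))
    && ~~ has_rainbow (fun x y => L (x, y)) k.+1].

Lemma linear_extension_exists : exists L, linear_extension L.
Proof.
pose h x := #|[set y : T | y < x]|.
pose L x y := (h x < h y)%N || ((h x == h y) && (enum_rank x < enum_rank y)%N).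
exists L; apply/and4P; split.
- by apply/forallP => x; rewrite /L !ltnn andbF.
- apply/'forall_forallP => x y; apply/forallP => z.
  apply/implyP => Lxy; apply/implyP; move: Lxy; rewrite /L.
  case/orP => [hxy|/andP[/eqP -> rxy]]; case/orP => [hyz|/andP[/eqP <- ryz]].
  + by rewrite (ltn_trans hxy hyz).
  + by rewrite hxy.
  + by rewrite hyz.
  + by rewrite eqxx (ltn_trans rxy ryz) orbT.
- apply/'forall_forallP => x y; apply/implyP => nxy; rewrite /L.
  case: (ltngtP (h x) (h y)) => //= _; rewrite -neq_ltn.
  by rewrite (inj_eq val_inj) (inj_eq enum_rank_inj).
- apply/'forall_forallP => x y; apply/implyP => xy; rewrite /L.
  apply/orP; left; apply/proper_card/properP; split.
    by apply/subsetP => z; rewrite !inE => /lt_trans; apply.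
  by exists x; rewrite !inE ?ltxx.
Qed.

Lemma queue_layout_exists : exists k, queue_layout k.
Proof.
case: linear_extension_exists => L HL; exists #|{: T * T}|.
apply/existsP; exists [ffun p => L p.1 p.2].
have E : (fun x y => [ffun p : T * T => L p.1 p.2] (x, y)) =2 L.
  by move=> x y; rewrite ffunE.
have [/forallP Li /'forall_forallP Lt Lc Le] := and4P HL.
apply/andP; split.
  apply/and4P; split.
  - by apply/forallP => x; rewrite E.
  - apply/'forall_forallP => x y; apply/forallP => z; rewrite !E.
    by have /forallP := Lt x y; apply.
  - by apply/'forall_forallP => x y; rewrite !E; move/'forall_forallP: Lc; apply.
  - by apply/'forall_forallP => x y; rewrite !E; move/'forall_forallP: Le; apply.
apply/existsP => -[s /andP[_]]; rewrite (eq_sorted E) => Ls.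
have Ltr : transitive L.
  move=> y x z Lxy Lyz; have /forallP/(_ z) := Lt x y.
  by rewrite Lxy Lyz.
have := sorted_uniq Ltr (fun x => negbTE (Li x)) Ls.
rewrite cat_uniq => /andP[/map_uniq/card_uniqP sU _].
by have := max_card [in s]; rewrite sU size_tuple ltnn.
Qed.

Definition qn : nat := ex_minn queue_layout_exists.

End QueueNumber.

Arguments width {d} T.
Arguments qn {d} T.

(* Main.v *)
Require Import Defs.
From mathcomp Require Import all_boot all_order.
From mathcomp Require Import zify.

(** The bound is obtained as [w ^ 2 - w] for [w >= 2] (and [1] for [w = 1]),
which is at most [w ^ 2 - 2 * (w %/ 2)].

Split the poset into [w] chains (Dilworth), called colors below.  In a rainbow
with respect to any linear extension, two nested covers [a < b] outside
[a' < b'] cannot have the same pair of colors (source, target): otherwise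
[a < a' < b] and [a < b] would not be a cover.  This gives at most [w ^ 2]
covers, one for each pair of colors, and it remains to find [w] pairs that do
not occur.

The linear extension is chosen lazily: it is built from the bottom up, and it
keeps taking elements of the same color for as long as one of them is minimal
among the remaining elements.  When the extension leaves the color of [x], the
next element [y] of that color is therefore above some element [c] of another
color that comes after [x] ([lazy_extension_exists]).  Hence no cover from the
color of [c] to the color of [x] can enclose both [x] and [y]: its source would
be below [c] and its target above [y].  So if every other color has such an
enclosing cover, the extension does not leave the color between [x] and [y]
([lazy_run]).

Count the missing pairs by target color, in columns.  If no column is complete,
every column misses a pair and there are [w] missing pairs.  Suppose now that
column [i] is complete.  Its cover inside color [i] joins two consecutive
elements of that color, so it lies inside the other covers of column [i].  Let
[p] be, among these, the one whose target comes first.  By laziness only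
elements of color [i] lie between the innermost cover and the target of [p],
and therefore all the remaining covers of the rainbow enclose [p]
([full_column_core]).  In particular column [i] is the only complete one.  Let
[j] be the color of the source of [p].  A cover inside color [j] cannot enclose
this source, so the pair (j, j) is missing; and if no other pair of column [j]
were missing, laziness at the source of [p] would forbid to leave color [j]
before the target of [p], which has color [i] ([full_column_defect]).  So column
[j] misses two pairs, which makes up for column [i]. *)

Set Implicit Arguments.
Unset Strict Implicit.
Unset Printing Implicit Defensive.
Import Order.TTheory.
Local Open Scope order_scope.

(** * Extremal elements *)

Lemma exists_maximal {d : Order.disp_t} {T : finPOrderType d} (P : pred T) x0 :
  P x0 -> exists2 m, P m & forall y, P y -> ~~ (m < y).
Proof.
move=> Px0; case: (arg_maxnP (fun x => #|[set y | y < x]|) Px0) => m Pm mmax.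
exists m => // y Py; apply/negP => my.
have := mmax y Py; rewrite /geq /= leqNgt => /negP; apply.
apply/proper_card/properP; split.
  by apply/subsetP => z; rewrite !inE => /lt_trans; apply.
by exists m; rewrite !inE ?ltxx.
Qed.

Lemma exists_minimal {d : Order.disp_t} {T : finPOrderType d} (P : pred T) x0 :
  P x0 -> exists2 m, P m & forall y, P y -> ~~ (y < m).
Proof. exact: (exists_maximal (T := T^d)). Qed.

Lemma exists_argmin (I : finType) (P : pred I) (F : I -> nat) i0 :
  P i0 -> exists2 i, P i & forall k, P k -> (F i <= F k)%N.
Proof. by move=> /(arg_minnP F)[i Pi imin]; exists i. Qed.

(** * Dilworth's theorem *)

Section Dilworth.
Context {d : Order.disp_t} {T : finPOrderType d}.
Implicit Types (x y z : T) (A B K : {set T}) (k : nat).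

Definition chain_coloring A k (f : T -> nat) : Prop :=
  {in A, forall x, (f x < k)%N} /\
  {in A &, forall x y, f x = f y -> x >=< y}.

Lemma chain_coloring_extend A K k f :
  (0 < k)%N -> {in K &, forall x y, x >=< y} ->
  chain_coloring (A :\: K) k.-1 f ->
  exists g, chain_coloring A k g.
Proof.
move=> k0 Kchain [flt fchain].
exists (fun x => if x \in K then k.-1 else f x); split=> [x xA|x y xA yA].
  case: ifPn => xK; first by rewrite prednK.
  by apply: leq_trans (leq_pred k); apply: flt; rewrite inE xK.
have fne z : z \in A -> z \notin K -> f z <> k.-1.
  move=> zA zK fz; have := flt z; rewrite inE zK zA fz ltnn.
  by move=> /(_ isT).
case: ifPn => xK; case: ifPn => yK.
- by move=> _; apply: Kchain.
- by move=> /esym /fne; case.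
- by move=> /fne; case.
- by apply: fchain; rewrite inE ?xK ?yK.
Qed.

Lemma antichainP A :
  reflect {in A &, forall x y, x <= y -> x = y} (antichain A).
Proof.
apply: (iffP 'forall_in_'forall_in_implyP) => AA x.
  move=> y xA yA xy; apply/eqP; case: (x =P y) => // /eqP.
  by move=> /(AA x xA y yA); rewrite /Order.comparable xy.
move=> xA y yA; apply: contraNT.
by rewrite negbK => /orP[/(AA _ _ xA yA) ->|/(AA _ _ yA xA) ->].
Qed.

(** Distinct elements of an antichain have distinct colors, so an antichain of
size [k] must use all the [k] colors. *)
Lemma antichain_colors A B k f :
  chain_coloring A k f -> B \subset A -> antichain B -> #|B| = k ->
  forall i, (i < k)%N -> exists2 z, z \in B & f z = i.
Proof.
move=> [flt fchain] /subsetP BA /antichainP Banti cB i ik.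
have finj : {in B &, injective f}.
  move=> x y xB yB /(fchain _ _ (BA _ xB) (BA _ yB)).
  by move=> /orP[/(Banti _ _ xB yB) ->|/(Banti _ _ yB xB) ->].
pose s := [seq f z | z in B].
have us : uniq s.
  rewrite map_inj_in_uniq ?enum_uniq // => x y; rewrite !mem_enum.
  exact: finj.
have sI : {subset s <= iota 0 k}.
  move=> _ /imageP[z zB ->]; rewrite mem_iota /=; exact/flt/BA.
have [_ eqs] : (size s = size (iota 0 k)) * (s =i iota 0 k).
  by apply: uniq_min_size => //; rewrite size_iota size_image cB.
have : i \in s by rewrite eqs mem_iota.
by move=> /imageP[z zB ->]; exists z.
Qed.

(** Galvin's argument.  Remove a maximal element [a] and color the rest.  If the
rest has no antichain of size [k], it needs only [k.-1] colors and [a] gets one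
of its own.  Otherwise take in each color the top element that lies
on such an antichain.  These tops form an antichain [X] of size [k], so [a] is
above some [x] in [X].  Then [a] and the elements of the color of [x] below [x]
form a chain that meets every antichain of size [k], and induction applies to
the complement of this chain. *)
Lemma dilworth A k :
  (forall B, B \subset A -> antichain B -> (#|B| <= k)%N) ->
  exists f, chain_coloring A k f.
Proof.
have [n] := ubnP #|A|; elim: n A k => // n IH A k ltA hA.
have [->|[a0 a0A]] := set_0Vmem A.
  by exists (fun=> 0%N); split=> [x|x y]; rewrite inE.
have [a aA amax] := exists_maximal (P := fun x => x \in A) a0A.
have sA'A : A :\ a \subset A by apply: subsetDl.
(* removing a set that contains [a] and meets all antichains of size [k] *)
have IHD K : a \in K ->
    (forall B, B \subset A :\: K -> antichain B -> (#|B| < k)%N) ->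
    (0 < k)%N /\ exists f, chain_coloring (A :\: K) k.-1 f.
  move=> aK hK.
  have k0 : (0 < k)%N.
    have := hK set0; rewrite cards0; apply; first exact: sub0set.
    by apply/antichainP => x y; rewrite inE.
  split=> //; apply: IH => [|B BK Banti].
    apply: leq_trans (_ : #|A| <= n)%N; last by [].
    apply: proper_card; apply/properP; split; first exact: subsetDl.
    by exists a; rewrite ?inE ?aK.
  by rewrite -ltnS prednK //; apply: hK.
pose full B := [&& B \subset A :\ a, antichain B & #|B| == k].
have [/existsP[B0 /and3P[B0A' B0anti /eqP cB0]]|/existsPn nofull] :=
    boolP [exists B, full B]; last first.
  have [||k0 [f fcol]] := IHD [set a]; first by rewrite inE.
    move=> B BA' Banti; rewrite ltn_neqAle hA //; last exact: subset_trans sA'A.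
    by have := nofull B; rewrite /full BA' Banti /= andbT.
  apply: chain_coloring_extend k0 _ fcol => x y.
  by rewrite !inE => /eqP -> /eqP ->; apply: comparablexx.
have [||f fcol] := IH (A :\ a) k.
- by move: ltA; rewrite (cardsD1 a A) aA.
- by move=> B BA'; apply: hA; apply: subset_trans sA'A.
(* [X] holds the top element of each color on an antichain of size [k] *)
pose good z := [exists B, full B && (z \in B)].
pose X := [set x | good x &&
  [forall z, good z && (f z == f x) ==> ~~ (x < z)]].
have goodA z : good z -> z \in A :\ a.
  by move=> /existsP[B /andP[/and3P[/subsetP BA' _ _]]]; apply: BA'.
have [flt fchain] := fcol.
have Xle x z : x \in X -> good z -> f z = f x -> z <= x.
  rewrite inE => /andP[gx /forallP xmax] gz fzx.
  have := xmax z; rewrite gz fzx eqxx /= => nxz.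
  have /orP[] := fchain _ _ (goodA _ gz) (goodA _ gx) fzx; first by [].
  by rewrite le_eqVlt (negPf nxz) orbF => /eqP ->.
have fullcolor B i : full B -> (i < k)%N -> exists2 z, z \in B & f z = i.
  move=> /and3P[BA' Banti /eqP cB]; exact: (antichain_colors fcol).
have Xanti : antichain X.
  apply/antichainP => x y xX yX xy.
  have gx : good x by move: (xX); rewrite inE => /andP[].
  move: (yX); rewrite inE => /andP[/existsP[B /andP[fB yB]] _].
  have [z zB fz] := fullcolor B (f x) fB (flt _ (goodA _ gx)).
  have gz : good z by apply/existsP; exists B; rewrite fB.
  have zx := Xle _ _ xX gz fz.
  have /and3P[_ /antichainP Banti _] := fB.
  have zy := Banti z y zB yB (le_trans zx xy).
  by apply/le_anti; rewrite xy -zy zx.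
have Xcolors i : (i < k)%N -> exists2 x, x \in X & f x = i.
  move=> ik.
  have fB0 : full B0 by rewrite /full B0A' B0anti cB0 /=.
  have [z zB fz] := fullcolor B0 i fB0 ik.
  have Pz : good z && (f z == i).
    by rewrite fz eqxx andbT; apply/existsP; exists B0; rewrite fB0.
  have [m /andP[gm /eqP fm] mmax] := 
    exists_maximal (P := fun z => good z && (f z == i)) Pz.
  exists m => //; rewrite inE gm; apply/forallP => y; apply/implyP.
  by rewrite fm; apply: mmax.
have XA' : X \subset A :\ a.
  by apply/subsetP => x; rewrite inE => /andP[/goodA].
have cX : (k <= #|X|)%N.
  rewrite -(size_iota 0 k) -(size_image f); apply: uniq_leq_size.
    exact: iota_uniq.
  move=> i; rewrite mem_iota => /Xcolors[x xX <-].
  exact: image_f.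
have [x xX xa] : exists2 x, x \in X & x < a.
  apply/exists_inP; apply: contraT => /exists_inPn nX.
  have aX : a \notin X by apply/negP => /(subsetP XA'); rewrite !inE eqxx.
  have : (#|a |: X| <= k)%N.
    apply: hA; first by rewrite subUset sub1set aA (subset_trans XA').
    have XA x : x \in X -> x \in A by move=> /(subsetP XA'); rewrite inE => /andP[].
    apply/antichainP => x y /setU1P[->|xX] /setU1P[->|yX] //.
    - by rewrite le_eqVlt (negPf (amax _ (XA _ yX))) orbF => /eqP.
    - by rewrite le_eqVlt (negPf (nX _ xX)) orbF => /eqP.
    - exact: (antichainP _ Xanti).
  by rewrite cardsU1 aX; move: cX; lia.
have gx : good x by move: (xX); rewrite inE => /andP[].
pose K := a |: [set z in A :\ a | (f z == f x) && (z <= x)].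
have [||k0 [g gcol]] := IHD K; first by rewrite !inE eqxx.
  move=> B BK Banti.
  have BA' : B \subset A :\ a.
    apply: (subset_trans BK); apply/subsetP => z.
    by rewrite !inE negb_or => /andP[/andP[-> _] ->].
  rewrite ltn_neqAle hA ?(subset_trans BA') // andbT; apply/negP => cB.
  have fB : full B by rewrite /full BA' Banti.
  have [z zB fz] := fullcolor B (f x) fB (flt _ (goodA _ gx)).
  have gz : good z by apply/existsP; exists B; rewrite fB.
  have := subsetP BK z zB; rewrite in_setD => /andP[/negP + _]; apply.
  by rewrite in_setU1 inE (goodA _ gz) fz eqxx (Xle _ _ xX gz fz) orbT.
apply: chain_coloring_extend k0 _ gcol => y z.
have Ka u : u \in [set z in A :\ a | (f z == f x) && (z <= x)] -> u <= a.
  by rewrite inE => /and3P[_ _ ux]; apply: ltW (le_lt_trans ux xa).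
move=> /setU1P[->|yK] /setU1P[->|zK].
- exact: comparablexx.
- by rewrite /Order.comparable (Ka _ zK) orbT.
- by rewrite /Order.comparable (Ka _ yK).
- move: yK zK; rewrite !inE -!in_setD1 => /and3P[yA' /eqP fy _] /and3P[zA' /eqP fz _].
  by apply: fchain; rewrite ?fy ?fz // !inE.
Qed.

End Dilworth.

(** * Lazy linear extensions *)

Section Lazy.
Context {d : Order.disp_t} {T : finPOrderType d} {C : eqType} (f : T -> C).
Implicit Types (x y z c : T) (s : seq T).

(** A lazy construction stopped after [size s] steps.  [take n s] is the set of
elements placed before step [n], so an element is available at step [n] when
all its predecessors are in [take n s]; at a change of color no element of the
previous color may be available. *)
Definition lazy_prefix s : Prop :=
  uniq s /\ forall n x0, (n < size s)%N ->
  let z := nth x0 s n in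
  (forall c, c < z -> c \in take n s) /\
  (forall m, n = m.+1 -> f (nth x0 s m) != f z ->
   forall y, f y = f (nth x0 s m) -> y \notin take n s ->
   exists2 c, c < y & c \notin take n s).

Lemma lazy_prefix_exists n :
  (n <= #|T|)%N -> exists2 s, lazy_prefix s & size s = n.
Proof.
elim: n => [_|n IH nT]; first by exists [::].
have [s [us Hs] sn] := IH (ltnW nT).
pose avail y := (y \notin s) && [forall c, (c < y) ==> (c \in s)].
have [z0 z0av] : exists z, avail z.
  have [y ys] : exists y, y \notin s.
    apply/existsP; apply: contraT => /existsPn sall.
    have : (#|T| <= #|s|)%N.
      apply/subset_leq_card/subsetP => y _; have := sall y; by rewrite negbK.
    by move=> /leq_trans/(_ (card_size s)); rewrite sn leqNgt nT.
  have [z zs zmin] := exists_minimal (P := fun z => z \notin s) ys.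
  exists z; rewrite /avail zs /=.
  by apply/forallP => c; apply/implyP; apply: contraTT => /zmin.
have [z zav zlazy] : exists2 z, avail z & forall x0 m, n = m.+1 ->
    f (nth x0 s m) != f z -> forall y, f y = f (nth x0 s m) -> ~~ avail y.
  have [z1 /andP[z1av /eqP fz1]|nz] :=
    pickP (fun z => avail z && (f z == f (last z0 s))).
    exists z1 => // x0 m nm; rewrite fz1 -nth_last sn nm /=.
    by rewrite (set_nth_default z0) ?eqxx // sn nm.
  exists z0 => // x0 m nm _ y; rewrite (set_nth_default z0) ?sn ?nm // => fy.
  apply/negP => yav; have /negP := negbT (nz y); apply.
  by rewrite yav fy -nth_last sn nm /= eqxx.
have /andP[zs /forallP zpred] := zav.
exists (rcons s z); last by rewrite size_rcons sn.
split=> [|i x0]; first by rewrite rcons_uniq zs.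
rewrite size_rcons ltnS leq_eqVlt => /orP[/eqP ->|ilt].
  rewrite nth_rcons ltnn eqxx -cats1 take_size_cat //; split=> [c cz|m sm].
    exact: (implyP (zpred c)).
  rewrite nth_cat sm ltnSn => fne y fy ys.
  have := zlazy x0 m; rewrite -sn sm => /(_ erefl fne y fy).
  rewrite negb_and ys /= => /forallPn[c].
  by rewrite negb_imply => /andP[cy cs]; exists c.
rewrite nth_rcons ilt -cats1 takel_cat ?(ltnW ilt) //.
have [Hdown Hlazy] := Hs i x0 ilt; split=> // m im.
by rewrite nth_cat -im ltnW //=; apply: Hlazy.
Qed.

(** The trace of laziness that the counting uses: if an element [z] of another
color comes between [x] and [y], then below [y] there is an obstruction [c]
that had not been placed when the extension left the color of [x].  In
the counting [y] is the target of a cover, or lies below one, so that [c] ends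
up strictly inside a cover that starts below it. *)
Definition no_early_switch (h : T -> nat) : Prop :=
  forall x z y, f x = f y -> f z != f x -> (h x < h z)%N -> (h z < h y)%N ->
  exists c, [/\ c < y, f c != f x & (h x < h c)%N].

(** The obstruction that [lazy_prefix] provides may have the color of [x]; it
then comes before [y] and is itself obstructed, so descending along the
extension ends at an obstruction of another color. *)
Lemma lazy_extension_exists : exists h : T -> nat,
  [/\ injective h, {homo h : x y / x < y >-> (x < y)%N} & no_early_switch h].
Proof.
have [s [us Hs] sT] := lazy_prefix_exists (leqnn #|T|).
have sall y : y \in s.
  have [_ ->] : (size s = size (enum T)) * (s =i enum T).
    apply: uniq_min_size => //; first by move=> x; rewrite mem_enum.
    by rewrite sT -cardE.
  by rewrite mem_enum.
have hlt y : (index y s < size s)%N by rewrite index_mem.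
have mono : {homo index^~ s : x y / x < y >-> (x < y)%N}.
  move=> x y xy; have [Hd _] := Hs (index y s) y (hlt y).
  by rewrite -in_take //; apply: Hd; rewrite nth_index.
exists (index^~ s); split=> //.
  by move=> x y /(congr1 (nth x s)); rewrite !nth_index.
move=> x z y fxy fzx xz zy.
(* [m] will be the last position of the run that starts at [x] *)
pose P n := (index x s < n)%N && (f (nth x s n) != f x).
have exP : exists n, P n by exists (index z s); rewrite /P xz nth_index.
case: (ex_minnP exP) => -[|m] // /andP[xm fm] mmin.
have mz : (m.+1 <= index z s)%N by apply: mmin; rewrite /P xz nth_index.
have fxm : f (nth x s m) = f x.
  apply/eqP; apply: contraT => fne.
  have xm' : (index x s < m)%N.
    rewrite ltn_neqAle -ltnS xm andbT; apply: contra fne => /eqP <-.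
    by rewrite nth_index.
  by have := mmin m; rewrite /P xm' fne ltnn; apply.
(* induction on a bound of the position of [u] *)
have unplaced n u : f u = f x -> (index u s < n)%N -> (m < index u s)%N ->
    exists c, [/\ c < u, f c != f x & (index x s < index c s)%N].
  elim: n u => // n IHn u fu un mu.
  have [_ /(_ _ erefl)] := Hs m.+1 x (leq_ltn_trans mz (hlt z)).
  rewrite fxm eq_sym => /(_ fm u fu).
  rewrite in_take // -leqNgt => /(_ mu)[c cu].
  rewrite in_take // -leqNgt => mc.
  have [fc|fc] := eqVneq (f c) (f x); last first.
    by exists c; split=> //; apply: leq_trans mc.
  have [|e [ec fe xe]] := IHn c fc _ mc; first exact: leq_trans (mono _ _ cu) _.
  by exists e; split=> //; apply: lt_trans cu.
apply: (unplaced (index y s).+1) => //.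
by apply: leq_trans zy; apply: ltnW.
Qed.

End Lazy.

(** * Missing color pairs of a rainbow *)

Section Counting.
Context {d : Order.disp_t} {T : finPOrderType d} {w : nat}.
Context (f : T -> 'I_w) (h : T -> nat).
Context (f_chain : forall x y, f x = f y -> x >=< y).
Context (h_mono : {homo h : x y / x < y >-> (x < y)%N}).
Context (h_lazy : no_early_switch f h).
Implicit Types (x y z c : T) (p q e : T * T) (i j k l : 'I_w).

Lemma lt_in_chain x y : f x = f y -> (h x < h y)%N -> x < y.
Proof.
move=> /f_chain xy hxy; have [//|yx|yx|xy'] := comparableP x y.
- by have := h_mono yx; lia.
- by move: xy; rewrite comparable_sym /Order.comparable; case: comparableP yx.
- by move: hxy; rewrite xy' ltnn.
Qed.

Lemma le_in_chain x y : f x = f y -> (h x <= h y)%N -> x <= y.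
Proof.
move=> fxy hxy; have /orP[//|] := f_chain fxy.
by rewrite le_eqVlt => /orP[/eqP->//|/h_mono]; rewrite ltnNge hxy.
Qed.

Lemma covers_ltF p c : covers p.1 p.2 -> p.1 < c -> c < p.2 -> False.
Proof.
move=> /andP[_ /existsPn nc] pc cp.
by have := nc c; rewrite pc cp.
Qed.

Lemma covers_lt p : covers p.1 p.2 -> (h p.1 < h p.2)%N.
Proof. by move=> /andP[/h_mono]. Qed.

(** If the extension left color [i] between [x] and [y], the obstruction [c]
would have a color [k] other than [i], and it would lie strictly between the
source and the target of the cover from color [k] to color [i] that encloses
[x] and [y]. *)
Lemma lazy_run i x y z :
  f x = i -> f y = i ->
  (forall k, k != i -> exists p,
     [/\ covers p.1 p.2, f p.1 = k, f p.2 = i, (h p.1 < h x)%N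
       & (h y <= h p.2)%N]) ->
  (h x < h z)%N -> (h z < h y)%N -> f z = i.
Proof.
move=> fx fy Hk xz zy; apply/eqP; apply: contraT => fz.
have [||c [cy fc xc]] := h_lazy _ _ xz zy; rewrite ?fx ?fy //.
have [|p [pcov p1 p2 px yp]] := Hk (f c); first by rewrite -fx.
case: (covers_ltF (c := c) pcov).
- by apply: lt_in_chain => //; apply: ltn_trans xc.
- by apply: lt_le_trans cy _; apply: le_in_chain; rewrite ?fy ?p2.
Qed.

Definition nested p q := ((h q.1 < h p.1) && (h p.2 < h q.2))%N.

(** Rainbows as sets of covers, with respect to the linear extension that sorts
the elements by [h]. *)
Definition nesting (E : {set T * T}) : Prop :=
  {in E, forall p, covers p.1 p.2} /\
  {in E &, forall p q, p != q -> nested p q || nested q p}.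

Definition chain_type p := (f p.1, f p.2).

Context (E : {set T * T}) (E_nesting : nesting E).

Let Ecov p : p \in E -> covers p.1 p.2.
Proof. exact: E_nesting.1. Qed.

(** Two nested covers with the same pair of colors would put the source of the
inner one strictly inside the outer one. *)
Lemma chain_type_inj : {in E &, injective chain_type}.
Proof.
have NO p q : p \in E -> q \in E -> chain_type p = chain_type q ->
    nested p q -> False.
  move=> pE qE [t1 t2] /andP[n1 n2].
  apply: (covers_ltF (Ecov qE)) (lt_in_chain _ n1) _; first by rewrite t1.
  apply: lt_trans (lt_in_chain t2 n2).
  by have /andP[] := Ecov pE.
move=> p q pE qE t; apply/eqP; apply: contraT => npq.
by have /orP[/NO|/NO] := E_nesting.2 p q pE qE npq; case.
Qed.

Definition missing := ~: (chain_type @: E).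

(** The target color is the second component, so that a column collects the
covers that end in a given chain. *)
Definition full_column i := [forall k, (k, i) \in chain_type @: E].

Lemma full_columnP i : full_column i ->
  forall k, exists2 p, p \in E & chain_type p = (k, i).
Proof. by move=> /forallP Fi k; have /imsetP[p pE ->] := Fi k; exists p. Qed.

Lemma uniform_no_between p z : p \in E -> f p.1 = f p.2 -> f z = f p.2 ->
  (h p.1 < h z)%N -> (h z < h p.2)%N -> False.
Proof.
move=> pE fp fz pz zp; apply: (covers_ltF (c := z) (Ecov pE)).
  by apply: lt_in_chain; rewrite ?fz.
exact: lt_in_chain.
Qed.

Lemma exists_neq i : (1 < w)%N -> exists k, k != i.
Proof.
move=> w1; have : (0 < #|[set~ i]|)%N by rewrite cardsC1 card_ord; lia.
by move=> /card_gt0P[k]; rewrite !inE => ki; exists k.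
Qed.

(** The two innermost covers of a rainbow with a complete column [i] are the
cover [e] inside color [i] and the next cover [p] of that column, because
by laziness there is nothing but color [i] between them on the right. *)
Lemma full_column_core i e : (1 < w)%N -> full_column i ->
  e \in E -> chain_type e = (i, i) ->
  exists p, [/\ p \in E, chain_type p <> (i, i), f p.2 = i, nested e p
    & forall q, q \in E -> q != e -> q != p -> nested p q].
Proof.
move=> w1 /full_columnP Fi eE [e1 e2].
have eout q : q \in E -> q != e -> f q.2 = i -> nested e q.
  move=> qE qe fq; have /orP[|//] := E_nesting.2 q e qE eE qe.
  move=> /andP[n1 n2]; case: (uniform_no_between (z := q.2) eE).
  - by rewrite e1.
  - by rewrite fq.
  - exact: ltn_trans n1 (covers_lt (Ecov qE)).
  - exact: n2.
pose P q := [&& q \in E, f q.1 != i & f q.2 == i].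
have [k0 k0i] := exists_neq i w1.
have [p0 p0E [p01 p02]] := Fi k0.
have P0 : P p0 by rewrite /P p0E p01 k0i p02 eqxx.
have [p /and3P[pE fp1 /eqP fp2] pmin] := exists_argmin (fun q => h q.2) P0.
have pe : p != e by apply: contra fp1 => /eqP ->; rewrite e1.
have nep := eout p pE pe fp2.
have run z : (h e.1 < h z)%N -> (h z < h p.2)%N -> f z = i.
  apply: (lazy_run e1 fp2) => k ki.
  have [q qE [q1 q2]] := Fi k.
  have qe : q != e by apply: contra ki => /eqP qe; rewrite -q1 qe e1.
  exists q; split=> //; first exact: Ecov.
    by have /andP[] := eout q qE qe q2.
  by apply: pmin; rewrite /P qE q1 ki q2 eqxx.
exists p; split=> // [[p1 _]|q qE qe qp]; first by rewrite p1 eqxx in fp1.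
have /orP[npq|//] := E_nesting.2 q p qE pE qp.
have /andP[n1 n2] := npq.
have hq := covers_lt (Ecov qE).
have he := covers_lt (Ecov eE).
(* [p] has the first target in column [i], apart from [e] *)
have hne : f q.2 <> i.
  move=> q2; have [q1|q1] := eqVneq (f q.1) i.
    case/eqP: qe; apply: chain_type_inj => //.
    by rewrite /chain_type q1 q2 e1 e2.
  by have := pmin q; rewrite /P qE q1 q2 eqxx leqNgt n2 => /(_ isT).
case: hne; apply: run n2.
have /orP[/andP[k1 _]|/andP[_ k2]] := E_nesting.2 q e qE eE qe.
  exact: ltn_trans k1 hq.
exact: ltn_trans he k2.
Qed.

(** The column that pays for the complete one is that of the source color [j] of
the cover [p] above.  All the covers with target color [j] enclose [p], since
[e] and [p] have target color [i]: a cover inside color [j]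
would jump over the source of [p], and with covers from all the other colors
the extension could not leave color [j] inside [p]. *)
Lemma full_column_defect i : (1 < w)%N -> full_column i ->
  exists j k, [/\ j != i, k != j, (j, j) \in missing & (k, j) \in missing].
Proof.
move=> w1 Fi; have [e eE et] := full_columnP Fi i.
have [p [pE pt p2 nep pout]] := full_column_core w1 Fi eE et.
have [e1 e2] := et.
pose j := f p.1; have ji : j != i.
  by apply/eqP => ji; apply: pt; rewrite /chain_type p2 -/j ji.
have pout_col k q : q \in E -> chain_type q = (k, j) -> nested p q.
  move=> qE [_ q2]; apply: pout => //.
    by apply: contra ji => /eqP qe; rewrite -q2 qe e2.
  by apply: contra ji => /eqP qp; rewrite -q2 qp p2.
have hp := covers_lt (Ecov pE).
have jj : (j, j) \in missing.
  rewrite inE; apply/negP => /imsetP[q qE /esym qt].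
  have [q1 q2] := qt.
  have /andP[n1 n2] := pout_col j q qE qt.
  by apply: (uniform_no_between (z := p.1) qE); rewrite ?q1 ?q2 //; lia.
have [/existsP[k /andP[kj kM]]|/existsPn nk] :=
  boolP [exists k, (k != j) && ((k, j) \in missing)]; first by exists j, k.
have col k : k != j -> exists2 q, q \in E & chain_type q = (k, j).
  move=> kj; have := nk k; rewrite kj inE negbK /=.
  by move=> /imsetP[q qE ->]; exists q.
pose P q := [&& q \in E, f q.1 != j & f q.2 == j].
have [q0 q0E [q01 q02]] := col i (negbT (etrans (eq_sym _ _) (negbTE ji))).
have P0 : P q0 by rewrite /P q0E q01 q02 eqxx eq_sym ji.
have [q /and3P[qE fq1 /eqP fq2] qmin] := exists_argmin (fun q => h q.2) P0.
have /andP[m1 m2] := pout_col (f q.1) q qE (congr1 (pair _) fq2).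
(* the target of [p] would be an element of color [i] inside a run of color [j] *)
case/eqP: ji; rewrite -p2; apply/esym.
apply: (lazy_run (x := p.1) _ fq2) hp m2 => // k kj.
have [r rE rt] := col k kj; have [r1 r2] := rt.
exists r; split=> //; first exact: Ecov.
  by have /andP[] := pout_col k r rE rt.
by apply: qmin; rewrite /P rE r1 r2 kj eqxx.
Qed.

(** The cover inside the color of a complete column is the innermost cover of
the rainbow, which leaves room for only one such column. *)
Lemma full_column_unique i l : (1 < w)%N -> full_column i -> full_column l -> i = l.
Proof.
move=> w1 Fi Fl; have [e eE et] := full_columnP Fi i.
have [e' eE' et'] := full_columnP Fl l.
apply/eqP; apply: contraT => il.
have inner i0 e0 q : full_column i0 -> e0 \in E -> chain_type e0 = (i0, i0) ->
    q \in E -> q != e0 -> (h q.1 < h e0.1)%N.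
  move=> F0 e0E et0 qE qe0.
  have [p [pE _ _ /andP[n1 _] pout]] := full_column_core w1 F0 e0E et0.
  have [-> //|qp] := eqVneq q p.
  by have /andP[n2 _] := pout q qE qe0 qp; apply: ltn_trans n1.
have ee' : e != e'.
  by apply: contra il => /eqP ee; move: et; rewrite ee et' => -[->].
have := inner _ _ _ Fl eE' et' eE ee'.
by have := inner _ _ _ Fi eE et eE'; rewrite eq_sym => /(_ ee'); lia.
Qed.

Lemma card_missing : (#|E| + #|missing| = w ^ 2)%N.
Proof.
rewrite -(card_in_imset chain_type_inj) cardsC card_prod card_ord.
by rewrite expnS expn1.
Qed.

(** Each column is charged with a missing pair of its own; the complete column
[i], if any, is charged with (j, j), and column [j] then with (k, j). *)
Lemma leq_card_missing : (1 < w)%N -> (w <= #|missing|)%N.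
Proof.
move=> w1.
suff [g ginj gM] : exists2 g : 'I_w -> 'I_w * 'I_w,
    injective g & forall l, g l \in missing.
  rewrite -[X in (X <= _)%N]card_ord -cardsT -(card_imset _ ginj).
  by apply: subset_leq_card; apply/subsetP => _ /imsetP[l _ ->].
pose miss l := odflt l [pick k | (k, l) \in missing].
have missP l : ~~ full_column l -> (miss l, l) \in missing.
  rewrite /miss; case: pickP => //= nM /forallPn[k].
  by have := nM k; rewrite inE => /negbFE ->.
have [/existsP[i Fi]|/existsPn nF] := boolP [exists i, full_column i]; last first.
  by exists (fun l => (miss l, l)) => [l l' []|l]; last exact/missP/nF.
have nF l : l != i -> ~~ full_column l.
  by apply: contra => Fl; apply/eqP/full_column_unique.
have [j [k [ji kj jjM kjM]]] := full_column_defect w1 Fi.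
exists (fun l => if l == i then (j, j) else if l == j then (k, j)
                 else (miss l, l)) => [l l'|l]; last first.
  by case: ifPn => // li; case: ifPn => // _; apply/missP/nF.
have [->|li] := eqVneq l i; have [->|l'i] := eqVneq l' i => //.
- have [_ [jk]|l'j [_ jl']] := eqVneq l' j; first by rewrite -jk eqxx in kj.
  by rewrite jl' eqxx in l'j.
- have [_ [jk]|lj [_ jl]] := eqVneq l j; first by rewrite jk eqxx in kj.
  by rewrite jl eqxx in lj.
have [->|lj] := eqVneq l j; have [->|l'j] := eqVneq l' j => //.
- by move=> [_ jl']; rewrite jl' eqxx in l'j.
- by move=> [_ jl]; rewrite jl eqxx in lj.
- by case.
Qed.

Lemma leq_card_nesting : (#|E| <= w ^ 2)%N.
Proof. by rewrite -card_missing leq_addr. Qed.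

Lemma leq_card_nesting_lazy : (1 < w)%N -> (#|E| + w <= w ^ 2)%N.
Proof. by move=> w1; rewrite -card_missing leq_add2l leq_card_missing. Qed.

End Counting.

(** * The queue number *)

Lemma rainbow_nesting {d : Order.disp_t} {T : finPOrderType d}
    (h : T -> nat) (s : seq (T * T)) :
  is_rainbow (fun x y => (h x < h y)%N) s ->
  nesting h [set p in s] /\ #|[set p in s]| = size s.
Proof.
have ltr : transitive (fun x y => (h x < h y)%N).
  by move=> y x z; apply: ltn_trans.
move=> /andP[/allP scov].
rewrite sorted_pairwise // pairwise_cat => /and3P[_ s1 s2].
have {s2} : pairwise (fun y x => (h x < h y)%N) (map snd s).
  move: (pairwise_sorted s2); rewrite rev_sorted sorted_pairwise // => y x z.
  by move=> yx zy; apply: ltn_trans yx.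
move: s1; rewrite !pairwise_map => s1 s2.
have sn : pairwise (fun p q => nested h q p) s.
  by rewrite pairwise_relI; apply/andP.
have us : uniq s.
  by apply: pairwise_uniq sn => p; rewrite /nested ltnn.
split; last by rewrite cardsE; apply/card_uniqP.
split=> [p|p q]; rewrite !inE; first exact: scov.
move=> ps qs npq.
have npos : index p s != index q s.
  by apply: contra npq => /eqP /(congr1 (nth p s)); rewrite !nth_index // => ->.
move/(pairwiseP p): sn => sn.
case: (ltngtP (index p s) (index q s)) => [pq|qp|pq].
- have := sn _ _ _ _ pq; rewrite !nth_index // => -> //; rewrite ?orbT //;
    by rewrite inE index_mem.
- have := sn _ _ _ _ qp; rewrite !nth_index // => -> //;
    by rewrite inE index_mem.
- by rewrite pq eqxx in npos.
Qed.

Lemma qn_leq {d : Order.disp_t} {T : finPOrderType d} (h : T -> nat) k :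
  injective h -> {homo h : x y / x < y >-> (x < y)%N} ->
  (forall s, is_rainbow (fun x y => (h x < h y)%N) s -> (size s <= k)%N) ->
  (qn T <= k)%N.
Proof.
move=> hinj hmono hk; rewrite /qn; case: ex_minnP => m _; apply.
apply/existsP; exists [ffun p => (h p.1 < h p.2)%N].
have E x y : [ffun p : T * T => (h p.1 < h p.2)%N] (x, y) = (h x < h y)%N.
  by rewrite ffunE.
apply/andP; split.
  apply/and4P; split.
  - by apply/forallP => x; rewrite E ltnn.
  - apply/'forall_forallP => x y; apply/forallP => z; rewrite !E.
    by apply/implyP => xy; apply/implyP; apply: ltn_trans.
  - apply/'forall_forallP => x y; rewrite !E; apply/implyP.
    by rewrite -neq_ltn (inj_eq hinj).
  - by apply/'forall_forallP => x y; rewrite !E; apply/implyP/hmono.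
apply/existsP => -[s]; rewrite /is_rainbow (eq_sorted E) => Hs.
by have := hk s Hs; rewrite size_tuple ltnn.
Qed.

Theorem corollary1 (w : nat) (d : Order.disp_t) (T : finPOrderType d) :
  (1 <= w)%N -> width T = w -> (qn T <= w ^ 2 - 2 * (w %/ 2))%N.
Proof.
move=> w0 wT.
have [g [glt gchain]] : exists g, chain_coloring [set: T] w g.
  apply: dilworth => B _ Banti; rewrite -wT /width.
  exact: (leq_bigmax_cond (F := fun A : {set T} => #|A|)).
pose f x : 'I_w := Ordinal (glt x (in_setT x)).
have f_chain x y : f x = f y -> x >=< y.
  by move=> [fxy]; apply: gchain; rewrite ?inE.
have [h [hinj hmono hlazy]] := lazy_extension_exists f.
apply: (qn_leq hinj hmono) => s /rainbow_nesting[nE sE].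
have := leq_card_nesting f_chain hmono nE.
have := leq_card_nesting_lazy f_chain hmono hlazy nE.
rewrite sE; case: (ltnP 1 w) => [_ /(_ isT)|w1 _]; first by lia.
have -> : w = 1%N by apply/eqP; rewrite eqn_leq w1.
by [].
Qed.
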